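(* Let $r$ be a positive integer, let $\sigma \in S_r$, let $\varepsilon, \lambda \in (0,1)$, and let $n$ and $d$ be positive integers such that $d \ge \frac{4000 r^5 (\log n)^2}{\varepsilon^3 \lambda^3}$, $\frac{\lambda}{4r} \le \varepsilon < \frac{1}{12}$, and $n$ is sufficiently large. Let $G$ be an $r$-line-graph on $n$ vertices which is a $(\lambda, d)$-expander. Then $G$ contains a $\sigma$-cycle of order at most $\frac{30 r \log n}{\varepsilon \lambda}$.
   Context: Logarithms are base $2$. An $r$-line-graph is a graph $G$ whose vertex set is a set of $r$-tuples in $A_1 \times \cdots \times A_r$, where $A_1, \ldots, A_r$ are pairwise disjoint sets, and in which two vertices are adjacent if and only if they differ in exactly one coordinate. Elements of $A_1 \cup \cdots \cup A_r$ are called coordinates; $\mathrm{coords}(x)$ is the set of coordinates of the tuple $x$. For a vertex $x$ and $i \in [r]$, $N^{(i)}(x)$ is the set of vertices of $G$ differing from $x$ in the $i$-th coordinate only, and $d^{(i)}(x) = |N^{(i)}(x)| + 1$; the minimum degree $\delta(G)$ is the minimum of $d^{(i)}(x)$ over all $x \in V(G)$, $i \in [r]$. A graph $H$ is a $\lambda$-expander if every vertex set $X$ with $|X| \le \frac12|V(H)|$ satisfies $|N(X)| \ge \lambda|X|$, where $N(X)$ is the set of vertices outside $X$ adjacent to some vertex of $X$. An $r$-line-graph $G$ is a $(\lambda,d)$-expander if it is a $\lambda$-expander and $\delta(G) \ge d$. For $\sigma \in S_r$ and vertices $x = (x_1,\ldots,x_r)$, $y = (y_1,\ldots,y_r)$,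 $y$ is a $\sigma$-neighbour of $x$ if $\mathrm{coords}(x) \cap \mathrm{coords}(y) = \emptyset$ and for each $i = 0,1,\ldots,r$ the tuple $z_i$ with $(z_i)_j = x_j$ if $\sigma^{-1}(j) > i$ and $(z_i)_j = y_j$ if $\sigma^{-1}(j) \le i$ is a vertex of $G$. A $\sigma$-cycle of order $k$ is a sequence $(x_1,\ldots,x_k)$ of vertices of $G$ with pairwise disjoint coordinate sets such that $x_{i+1}$ is a $\sigma$-neighbour of $x_i$ for every $i \in [k]$, indices taken modulo $k$. *)

(* Defs.v *)
From mathcomp Require Import all_boot all_order all_algebra all_fingroup finmap.
From mathcomp Require Import all_classical all_reals all_analysis.

Set Implicit Arguments.
Unset Strict Implicit.
Unset Printing Implicit Defensive.
Import Order.TTheory GRing.Theory Num.Theory.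
Local Open Scope ring_scope.

Definition log2 (R : realType) (x : R) : R := ln x / ln 2.

Definition nbhd (T : finType) (e : rel T) (X : {set T}) : {set T} :=
  [set y in ~: X | [exists x in X, e x y]].

Definition expander (R : realType) (T : finType) (e : rel T) (lam : R) : Prop :=
  forall X : {set T},
    #|X|%:R <= 2^-1 * #|T|%:R :> R -> lam * #|X|%:R <= #|nbhd e X|%:R.

(* Nothing is assumed about the ambient type of coordinates or about the parts,
   which may be infinite; only the set of vertices is finite. *)
Record line_graph (r : nat) := LineGraph {
  coordinate : choiceType;
  part : 'I_r -> set coordinate;
  vertices : {fset r.-tuple coordinate};
  part_disjoint : trivIset setT part;
  vertices_in_part : forall x, x \in vertices -> forall i, part i (tnth x i) }.

Definition coords (C : choiceType) (r : nat) (x : r.-tuple C) : {fset C} :=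
  [fset c in (x : seq C)]%fset.

Definition diff_coords (C : choiceType) (r : nat) (x y : r.-tuple C) :
  {set 'I_r} := [set i | tnth x i != tnth y i].

Definition line_adj (r : nat) (G : line_graph r) : rel (vertices G) :=
  fun x y => #|diff_coords (val x) (val y)| == 1%N.

Definition dir_nbhd (r : nat) (G : line_graph r) (i : 'I_r) (x : vertices G) :
  {set vertices G} := [set y | diff_coords (val x) (val y) == [set i]].

Definition dir_degree (r : nat) (G : line_graph r) (i : 'I_r)
  (x : vertices G) : nat := #|dir_nbhd i x|.+1.

(* The default value of the minimum is an upper bound of all the degrees, see
   dir_degree_le, so it does not affect the minimum of a nonempty family. *)
Definition min_degree (r : nat) (G : line_graph r) : nat :=
  \big[minn/#|{: vertices G}|]_(x : vertices G)
    \big[minn/#|{: vertices G}|]_(i < r) dir_degree i x.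

Definition line_expander (R : realType) (r : nat) (G : line_graph r)
  (lam : R) (d : nat) : Prop :=
  expander (@line_adj r G) lam /\ (d <= min_degree G)%N.

(* Positions are numbered from 0, so that the condition that the preimage under
   s of the 1-based position j is at most i becomes a strict inequality. *)
Definition mixed_tuple (C : choiceType) (r : nat) (s : 'S_r)
  (x y : r.-tuple C) (i : nat) : r.-tuple C :=
  [tuple if ((s^-1)%g j < i)%N then tnth y j else tnth x j | j < r].

Definition sigma_neighbour (r : nat) (G : line_graph r) (s : 'S_r) :
  rel (vertices G) :=
  fun x y => [disjoint coords (val x) & coords (val y)]%fset &&
    [forall i : 'I_r.+1, mixed_tuple s (val x) (val y) i \in vertices G].

(* The order of the cycle c is its size. *)
Definition sigma_cycle (r : nat) (G : line_graph r) (s : 'S_r)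
  (c : seq (vertices G)) : Prop :=
  [/\ (0 < size c)%N,
      pairwise (fun x y => [disjoint coords (val x) & coords (val y)]%fset) c
    & path.cycle (sigma_neighbour s) c].

Lemma dir_degree_le (r : nat) (G : line_graph r) (i : 'I_r) (x : vertices G) :
  (dir_degree i x <= #|{: vertices G}|)%N.
Proof.
have xN : x \notin dir_nbhd i x.
  rewrite inE; apply/eqP => /setP /(_ i).
  by rewrite !inE !eqxx.
by rewrite /dir_degree -add1n -[1%N]/(true : nat) -xN -cardsU1 max_card.
Qed.

Lemma bigminn_le (I : finType) (m : nat) (F : I -> nat) (i : I) :
  (\big[minn/m]_(j : I) F j <= F i)%N.
Proof.
have: i \in index_enum I by rewrite mem_index_enum.
elim: (index_enum I) => // j s IH; rewrite inE big_cons geq_min.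
by case/predU1P => [<-|/IH ->]; rewrite ?leqnn ?orbT.
Qed.

Lemma leq_min_degree (r : nat) (G : line_graph r) (d : nat) :
  (0 < r)%N -> (0 < #|{: vertices G}|)%N ->
  (d <= min_degree G)%N <->
  (forall (x : vertices G) (i : 'I_r), (d <= dir_degree i x)%N).
Proof.
move=> r0 /card_gt0P[x0 _]; split=> [dG x i|dG].
  apply: leq_trans dG (leq_trans (bigminn_le _ _ x) _).
  exact: (bigminn_le _ (fun j => dir_degree j x)).
have dT : (d <= #|{: vertices G}|)%N.
  exact: leq_trans (dG x0 (Ordinal r0)) (dir_degree_le _ _).
rewrite /min_degree; elim/big_ind: _ => // [a b|x _]; first by rewrite leq_min => -> ->.
by elim/big_ind: _ => // a b; rewrite leq_min => -> ->.
Qed.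

(* Main.v *)
(* Fix a vertex x and a set F of forbidden coordinates with |F| << lam d / r.
   Let Y_t be the set of ends of sigma-paths with t steps from x that avoid F.
   Changing the coordinates one at a time, in the order given by sigma, a line of
   direction i which meets the set reached so far is contained in the next set,
   up to the few vertices whose new coordinate is forbidden or already used.
   As lines have at least d vertices, the reached sets are almost increasing
   during a round, so that Y_{t+1} almost contains Y_t and its neighbours, and
   expansion gives |Y_t| >= 4n/5 for some t <= l, where l is about
   20 (log n) / lam.

   By choosing the paths greedily and forbidding the coordinates which have been
   used too often, one gets, from every x to 4/5 of the vertices y, paths p x y
   such that, for a fixed x, each coordinate lies on less than n / (8 l r) of them.
   For random x, y, z, the path p x y is defined with probability at least 4/5,
   and then p y z meets p x y with probability at most 1/8, since z is
   independent of (x, y); the same holds after rotating (x, y, z).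
   As 3 (1/5 + 1/8) < 1, some closed walk p x y ++ p y z ++ p z x is a sigma-cycle.
*)
Require Import Defs.
From mathcomp Require Import all_boot all_order all_algebra all_fingroup finmap.
From mathcomp Require Import all_classical all_reals all_analysis.
From mathcomp Require Import zify ring lra.

Set Implicit Arguments.
Unset Strict Implicit.
Unset Printing Implicit Defensive.

Import Order.TTheory GRing.Theory Num.Theory.
Local Open Scope ring_scope.

(** * Counting by equivalence classes, and expansion of closed neighbourhoods *)

Section Classes.
Variables (T : finType) (cls : T -> {set T}).
Hypothesis cls_refl : forall x, x \in cls x.
Hypothesis cls_eq : forall x y, y \in cls x -> cls y = cls x.

Lemma card_bigcup_classes (A B : {set T}) :
  #|(\bigcup_(x in A) cls x) :&: B| = (\sum_(S in cls @: A) #|S :&: B|)%N.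
Proof.
rewrite -sum1_card (partition_big cls (mem (cls @: A))) /=; last first.
  move=> z /setIP[/bigcupP[x xA zx] _].
  by rewrite (cls_eq zx) imset_f.
apply: eq_bigr => S /imsetP[x xA ->]; rewrite -sum1_card.
apply: eq_bigl => z; rewrite !inE.
have -> : (cls z == cls x) = (z \in cls x).
  by apply/eqP/idP => [<-|/cls_eq].
rewrite andbAC; congr (_ && _).
by apply/andP/idP => [[]|zx] //; split=> //; apply/bigcupP; exists x.
Qed.

(** Distinct classes are disjoint, so the hypothesis is summed once per class and the parts inside
    [B] add up to at most [#|B|]. The classes will be the lines of one direction. *)
Lemma bigcup_classes_defect (R : realType) (del : R) (A B : {set T}) :
  0 <= del ->
  (forall x, x \in A -> #|cls x :\: B|%:R <= del * #|cls x :&: B|%:R) ->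
  #|(\bigcup_(x in A) cls x) :\: B|%:R <= del * #|B|%:R.
Proof.
move=> del0 AB.
apply: (@le_trans _ _ (del * #|(\bigcup_(x in A) cls x) :&: B|%:R)); last first.
  by rewrite ler_wpM2l // ler_nat subset_leq_card // subsetIr.
rewrite finset.setDE !card_bigcup_classes !natr_sum mulr_sumr.
by apply: ler_sum => S /imsetP[x xA ->]; rewrite -finset.setDE AB.
Qed.

End Classes.

Lemma card_bigcup_ord_le (R : realType) (T : finType) (r : nat)
    (A : 'I_r -> {set T}) (c : R) :
  (forall i, #|A i|%:R <= c) -> #|\bigcup_i A i|%:R <= r%:R * c.
Proof.
move=> Ac.
have -> : r%:R * c = \sum_(i < r) c.
  by rewrite sumr_const card_ord mulr_natl.
apply: le_trans (_ : (\sum_(i < r) #|A i|)%:R <= _); last first.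
  by rewrite natr_sum ler_sum.
rewrite ler_nat.
elim/big_rec2: _ => [|i m B _ IH]; first by rewrite cards0.
by rewrite (leq_trans (leq_card_setU _ _)) // leq_add2l.
Qed.

(** When [X] has more than half of the vertices, expansion is applied to the complement of [W], the
    closed neighbourhood of [X]. All neighbours of that complement lie in [nbhd e X], and it has at
    least [#|T| / 6 >= #|X| / 6] elements, whence the factor [lam / 6]. *)
Lemma expander_closed_nbhd (R : realType) (T : finType) (e : rel T) (lam : R)
    (X : {set T}) :
  symmetric e -> 0 < lam -> expander e lam ->
  6 * #|X :|: nbhd e X|%:R <= 5 * #|T|%:R :> R ->
  (1 + lam / 6) * #|X|%:R <= #|X :|: nbhd e X|%:R.
Proof.
move=> es lam0 exp W5.
set W := X :|: nbhd e X in W5 *.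
have cardW : (#|W| = #|X| + #|nbhd e X|)%N.
  rewrite cardsU (_ : X :&: _ = finset.set0) ?cards0 ?subn0 //.
  by apply/setP => x; rewrite !inE; case: (x \in X).
have cardC : (#|W| + #|~: W| = #|T|)%N by rewrite cardsC.
have cardNC : (#|nbhd e (~: W)| <= #|nbhd e X|)%N.
  apply/subset_leq_card/fintype.subsetP => y; rewrite !inE negbK => /andP[yW /existsP[x]].
  rewrite !inE => /andP[xW exy]; move: yW.
  case: (boolP (y \in X)) => //= yX _; move: xW; rewrite negb_or => /andP[xX].
  rewrite xX /= => /existsP[]; exists y.
  by rewrite yX es.
have := exp X; have := exp (~: W).
move: cardW cardC cardNC W5 => /(congr1 (fun k => k%:R : R)).
move=> + /(congr1 (fun k => k%:R : R)); rewrite !natrD -(ler_nat R).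
have := ler0n R #|X|; have := ler0n R #|~: W|; have := ler0n R #|nbhd e X|.
move: (#|X|%:R : R) (#|~: W|%:R : R) (#|nbhd e X|%:R : R) (#|W|%:R : R)
  (#|T|%:R : R) (#|nbhd e (~: W)|%:R : R) => x c m w n m' m0 c0 x0 -> nE m'm.
move=> W5 expC expX.
case: (lerP x (2^-1 * n)) => [/expX xm|xn].
  by have := mulr_ge0 (ltW lam0) x0; lra.
have /expC cm' : c <= 2^-1 * n by lra.
have : 0 <= lam * (6 * c - x) by rewrite mulr_ge0 ?(ltW lam0) //; lra.
by rewrite mulrBr; lra.
Qed.

(** * Lines of a line graph, and growth during one round of coordinate changes *)

Section Lines.
Variables (r : nat) (G : line_graph r).
Implicit Types (i : 'I_r) (x y : vertices G).

(** Unlike [dir_nbhd i x], this contains [x], so the lines of direction [i] partition the vertices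
    and have exactly [dir_degree] elements. *)
Definition line i x : {set vertices G} :=
  [set y | diff_coords (val x) (val y) \subset [set i]].

Lemma lineP i x y :
  reflect (forall j, j != i -> tnth (val x) j = tnth (val y) j) (y \in line i x).
Proof.
rewrite inE; apply: (iffP fintype.subsetP) => [sub j ji|eqj j].
  apply/eqP; move: (sub j); rewrite !inE (negbTE ji).
  by case: eqP => // _ /(_ isT).
by rewrite !inE; apply: contraR => /eqj /eqP.
Qed.

Lemma line_refl i x : x \in line i x.
Proof. exact/lineP. Qed.

Lemma line_eq i x y : y \in line i x -> line i y = line i x.
Proof.
move=> /lineP yx; apply/setP => z.
by apply/lineP/lineP => h j ji; rewrite -?h ?yx // -yx // h.
Qed.

Lemma card_line i x : #|line i x| = dir_degree i x.
Proof.
have -> : line i x = x |: dir_nbhd i x.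
  apply/setP => y; rewrite !inE subset1 orbC; congr (_ || _).
  apply/eqP/eqP => [/setP h|->]; last by apply/setP => j; rewrite !inE eqxx.
  apply/val_inj/eq_from_tnth => j; apply/esym/eqP.
  by move: (h j); rewrite !inE; case: eqP.
rewrite cardsU1 !inE /dir_degree.
suff -> : (diff_coords (val x) (val x) == [set i]) = false by [].
by apply/eqP => /setP/(_ i); rewrite !inE !eqxx.
Qed.

Lemma line_adj_sym : symmetric (@line_adj r G).
Proof.
move=> x y; rewrite /line_adj; congr (#|pred_of_set _| == _).
by apply/setP => j; rewrite !inE eq_sym.
Qed.

Lemma line_adj_line x y : line_adj x y -> exists i, y \in line i x.
Proof. by case/cards1P => i xyi; exists i; rewrite inE xyi. Qed.

End Lines.

(** Let [E] collect the vertices lost at some stage of the round. Then [X = Z 0 :\: E] survives all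
    stages. A neighbour of [X] is on a line of some direction [s k] through [X], so it enters
    [Z k.+1] unless it belongs to a small set [E']. Hence [Z r] contains the closed neighbourhood of
    [X] up to [E] and [E'], whose sizes cost at most half of the gain [lam / 6]. *)
Lemma round_growth (R : realType) (r : nat) (G : line_graph r) (s : 'S_r)
    (lam : R) (Z : nat -> {set vertices G}) :
  (0 < r)%N -> 0 < lam < 1 -> expander (@line_adj r G) lam ->
  (forall (k : 'I_r) x, x \in Z k ->
     #|line (s k) x :\: Z k.+1|%:R
       <= lam / (160 * r%:R) * #|line (s k) x :&: Z k.+1|%:R) ->
  4 * #|{: vertices G}|%:R <= 5 * #|Z r|%:R :> R \/
  (1 + lam / 12) * #|Z 0|%:R <= #|Z r|%:R :> R.
Proof.
move=> r0 /andP[lam0 lam1] exp; set del := lam / _ => Zline.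
have r0R : 0 < r%:R :> R by rewrite ltr0n.
have del0 : 0 <= del by rewrite divr_ge0 ?mulr_ge0 ?ltW.
have rdel : r%:R * del = lam / 160.
  by rewrite /del; field; rewrite gt_eqF.
have defect (k : 'I_r) (A : {set vertices G}) : A \subset Z k ->
    #|(\bigcup_(x in A) line (s k) x) :\: Z k.+1|%:R <= del * #|Z k.+1|%:R.
  move=> /fintype.subsetP AZ; apply: bigcup_classes_defect => //.
  - exact: line_refl.
  - by move=> x y; apply: line_eq.
  - by move=> x /AZ; apply: Zline.
have stepD (k : 'I_r) : #|Z k :\: Z k.+1|%:R <= del * #|Z k.+1|%:R.
  apply: le_trans (defect k (Z k) (subxx _)); rewrite ler_nat.
  apply/subset_leq_card/finset.setSD/fintype.subsetP => x xZ.
  by apply/bigcupP; exists x => //; apply: line_refl.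
(* Backward induction from [Z r], by [(1 - j.+1 * del) * (1 + del) <= 1 - j * del]. *)
have Zj j : (j <= r)%N -> (1 - j%:R * del) * #|Z (r - j)%N|%:R <= #|Z r|%:R :> R.
  elim: j => [|j IH] jr; first by rewrite mul0r subr0 mul1r subn0.
  have jr' : (r - j.+1 < r)%N by rewrite ltn_subrL.
  have := stepD (Ordinal jr') => /=; rewrite -subSn // subSS => stj.
  apply: le_trans (IH (ltnW jr)).
  have : #|Z (r - j.+1)%N|%:R <= (1 + del) * #|Z (r - j)%N|%:R :> R.
    rewrite mulrDl mul1r; apply: le_trans (lerD (lexx _) stj).
    rewrite -natrD ler_nat -(finset.cardsID (Z (r - j)%N) (Z (r - j.+1)%N)).
    by rewrite leq_add2r subset_leq_card // finset.subsetIr.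
  have jd0 : 0 <= j.+1%:R * del by rewrite mulr_ge0.
  have jd1 : j.+1%:R * del <= 1.
    apply: (@le_trans _ _ (r%:R * del)); last by rewrite rdel; lra.
    by rewrite ler_wpM2r // ler_nat.
  move=> /(ler_wpM2l (x := 1 - j.+1%:R * del)); rewrite subr_ge0.
  move=> /(_ jd1) /le_trans; apply.
  rewrite mulrA ler_wpM2r //; move: jd0; rewrite -natr1 mulrDl mul1r => jd0.
  have := mulr_ge0 jd0 del0; lra.
have Zle2 k : (k <= r)%N -> #|Z k|%:R <= 2 * #|Z r|%:R :> R.
  move=> kr; have := Zj (r - k)%N (leq_subr _ _); rewrite subKn //.
  have : (r - k)%:R * del <= 2^-1.
    apply: (@le_trans _ _ (r%:R * del)); last by rewrite rdel; lra.
    by rewrite ler_wpM2r // ler_nat leq_subr.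
  have := ler0n R #|Z k|; nra.
set E := \bigcup_(k < r) (Z k :\: Z k.+1).
(* Each of the [r] stages loses at most [del * (2 * #|Z r|)], and [r * del = lam / 160]. *)
have cE : 80 * #|E|%:R <= lam * #|Z r|%:R :> R.
  apply: (@le_trans _ _ (80 * (r%:R * del * (2 * #|Z r|%:R)))).
    rewrite ler_wpM2l // -mulrA; apply: card_bigcup_ord_le => k.
    by apply: le_trans (stepD k) _; rewrite ler_wpM2l // Zle2.
  by rewrite rdel; lra.
pose X := Z 0 :\: E.
have notE k x : (k < r)%N -> x \in Z k -> x \notin E -> x \in Z k.+1.
  move=> kr xZ; apply: contraR => xZ'; apply/bigcupP.
  by exists (Ordinal kr) => //=; rewrite !inE xZ' xZ.
have notEr k x : (k <= r)%N -> x \in Z k -> x \notin E -> x \in Z r.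
  move=> kr xZ xE; have : (k + (r - k) <= r)%N by rewrite subnKC.
  suff /[apply] : forall j, (k + j <= r)%N -> x \in Z (k + j)%N by rewrite subnKC.
  elim=> [|j IH]; first by rewrite addn0.
  by rewrite addnS => jr; apply: notE => //; apply: IH; apply: ltnW.
have XZ (k : 'I_r) : X \subset Z k.
  apply/fintype.subsetP => x; rewrite !inE => /andP[xE xZ].
  have := ltnW (ltn_ord k); elim: (k : nat) => // j IH jr.
  by apply: notE => //; apply: IH; apply: ltnW.
pose E' := \bigcup_(k < r) ((\bigcup_(x in X) line (s k) x) :\: Z k.+1).
have cE' : 80 * #|E'|%:R <= lam * #|Z r|%:R :> R.
  apply: (@le_trans _ _ (80 * (r%:R * del * (2 * #|Z r|%:R)))).
    rewrite ler_wpM2l // -mulrA; apply: card_bigcup_ord_le => k.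
    by apply: le_trans (defect k X (XZ k)) _; rewrite ler_wpM2l // Zle2.
  by rewrite rdel; lra.
have WZ : X :|: nbhd (@line_adj r G) X \subset Z r :|: E :|: E'.
  have XW x k : x \in \bigcup_(x in X) line (s k) x ->
      x \in Z r :|: E :|: E'.
    move=> xU; rewrite !inE -orbA; case: (boolP (x \in E)) => [|xE].
      by rewrite orbT.
    case: (boolP (x \in Z k.+1)) => [xZ|xZ]; first by rewrite (notEr k.+1).
    rewrite orbCA; apply/orP; right; apply/orP; right; apply/bigcupP.
    by exists k => //; rewrite inE xZ.
  apply/fintype.subsetP => y /setUP[yX|].
    apply: (XW y (Ordinal r0)); apply/bigcupP; exists y => //.
    exact: line_refl.
  rewrite inE => /andP[_ /existsP[x /andP[xX /line_adj_line[i yi]]]].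
  apply: (XW y (s^-1%g i)); apply/bigcupP; exists x => //.
  by rewrite permKV.
have cW : #|X :|: nbhd (@line_adj r G) X|%:R
    <= #|Z r|%:R + #|E|%:R + #|E'|%:R :> R.
  rewrite -!natrD ler_nat (leq_trans (subset_leq_card WZ)) //.
  apply: leq_trans (leq_card_setU _ _) _.
  by rewrite leq_add2r leq_card_setU.
have cX : #|Z 0|%:R <= #|X|%:R + #|E|%:R :> R.
  rewrite -natrD ler_nat addnC -(finset.cardsID E (Z 0)) leq_add2r.
  by rewrite subset_leq_card // finset.subsetIr.
have Zn : #|Z r|%:R <= #|{: vertices G}|%:R :> R by rewrite ler_nat max_card.
have := expander_closed_nbhd (@line_adj_sym r G) lam0 exp (X := X).
move: cE cE' cW cX Zn.
move: (ler0n R #|Z r|) (ler0n R #|X|) (ler0n R #|Z 0|).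
move: (#|Z r|%:R : R) (#|E|%:R : R) (#|E'|%:R : R) (#|X|%:R : R)
  (#|Z 0|%:R : R) (#|X :|: _|%:R : R) (#|{: vertices G}|%:R : R).
move=> N e e' x z w n N0 x0 z0 eN e'N wN zx Nn W.
have lamN : lam * N <= N by rewrite ler_piMl // ltW.
case: (lerP (6 * w) (5 * n)) => [/W {}W|wn]; last by left; lra.
right; nra.
Qed.

(** * Paths avoiding a list of coordinates, and the sets of their ends *)

Section AvoidingPaths.
Variables (r : nat) (G : line_graph r) (s : 'S_r).
Implicit Types (x y z : vertices G) (p : seq (vertices G)).
Implicit Types F : seq (coordinate G).

Definition path_coords p : seq (coordinate G) :=
  flatten [seq val (val y) | y <- p].

Lemma path_coords_cat p q : path_coords (p ++ q) = path_coords p ++ path_coords q.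
Proof. by rewrite /path_coords map_cat flatten_cat. Qed.

Lemma size_path_coords p : size (path_coords p) = (size p * r)%N.
Proof.
elim: p => //= y p IH; rewrite -cat1s path_coords_cat size_cat IH mulSn.
by rewrite /path_coords /= cats0 size_tuple.
Qed.

Lemma path_coordsP c p :
  reflect (exists2 y, y \in p & c \in val (val y)) (c \in path_coords p).
Proof.
apply: (iffP flattenP) => [[_ /mapP[y yp ->]]|[y yp yc]]; first by exists y.
by exists (val (val y)) => //; apply: map_f.
Qed.

Definition coord_disjoint x y : bool :=
  [disjoint coords (val x) & coords (val y)]%fset.

Lemma coord_disjointP x y :
  reflect (forall c, c \in val (val x) -> c \notin val (val y))
          (coord_disjoint x y).
Proof.
apply: (iffP idP) => [/fdisjointP h c|h].
  by move: (h c); rewrite !in_fsetE.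
by apply/fdisjointP => c; rewrite !in_fsetE; apply: h.
Qed.

(** The start [x] is exempt from avoiding [F], and its coordinates are left out of [path_coords p]:
    they are common to all paths from [x], so their use could not be spread out. *)
Definition avoiding_path F x p : bool :=
  [&& path.path (sigma_neighbour s) x p, pairwise coord_disjoint (x :: p)
    & all (fun c => c \notin F) (path_coords p)].

Lemma avoiding_path_rcons F x p y :
  avoiding_path F x p -> sigma_neighbour s (last x p) y ->
  (forall c, c \in val (val y) -> c \notin F ++ path_coords (x :: p)) ->
  avoiding_path F x (rcons p y).
Proof.
move=> /and3P[pp pd pF] py yF; apply/and3P; split.
- by rewrite rcons_path pp.
- rewrite -rcons_cons pairwise_rcons pd andbT; apply/allP => z zp.
  apply/coord_disjointP => c cz; apply/negP => /yF; apply/negP; rewrite negbK.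
  by rewrite mem_cat; apply/orP; right; apply/path_coordsP; exists z.
- rewrite -cats1 path_coords_cat all_cat pF; apply/allP => c.
  rewrite /path_coords /= cats0 => /yF; rewrite mem_cat negb_or.
  by case/andP.
Qed.

(* The first k coordinates of the last vertex of p, in the order given by s,
   have been changed into those of y. *)
Definition partial_step F x p k y : Prop :=
  [/\ avoiding_path F x p,
      forall i, (i <= k)%N ->
        mixed_tuple s (val (last x p)) (val y) i \in vertices G,
      forall j, (k <= (s^-1)%g j)%N -> tnth (val y) j = tnth (val (last x p)) j
    & forall j, ((s^-1)%g j < k)%N ->
        tnth (val y) j \notin F ++ path_coords (x :: p)].

Lemma partial_step0 F x p : avoiding_path F x p -> partial_step F x p 0 (last x p).
Proof.
move=> pp; split=> // i; rewrite leqn0 => /eqP ->.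
suff -> : mixed_tuple s (val (last x p)) (val (last x p)) 0 = val (last x p).
  exact: valP.
by apply: eq_from_tnth => j; rewrite tnth_mktuple.
Qed.

(** The mixed tuples of index at most [k] do not read position [s k] of the new end, and the one of
    index [k.+1] is [z] itself. *)
Lemma partial_stepS F x p (k : 'I_r) y z :
  partial_step F x p k y -> z \in line (s k) y ->
  tnth (val z) (s k) \notin F ++ path_coords (x :: p) ->
  partial_step F x p k.+1 z.
Proof.
move=> [pp pm pold pnew] /lineP yz zF.
have sE j : ((s^-1)%g j == k :> nat) = (j == s k).
  by apply/eqP/eqP => [/val_inj <-|->]; rewrite ?permKV ?permK.
split=> // [i|j jk|j].
- rewrite leq_eqVlt ltnS => /predU1P[->|ik].
    suff -> : mixed_tuple s (val (last x p)) (val z) k.+1 = val z by exact: valP.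
    apply: eq_from_tnth => j; rewrite tnth_mktuple; case: ltnP => // jk.
    rewrite -yz ?pold //; first exact: ltnW.
    by rewrite -sE gtn_eqF.
  suff -> : mixed_tuple s (val (last x p)) (val z) i =
            mixed_tuple s (val (last x p)) (val y) i by exact: pm.
  apply: eq_from_tnth => j; rewrite !tnth_mktuple; case: ltnP => // ji.
  by rewrite yz // -sE ltn_eqF // (leq_trans ji).
- rewrite -yz ?pold //; first exact: ltnW.
  by rewrite -sE gtn_eqF.
- rewrite ltnS leq_eqVlt sE => /predU1P[->//|jk].
  by rewrite -yz ?pnew // -sE ltn_eqF.
Qed.

Lemma partial_step_full F x p y :
  partial_step F x p r y -> avoiding_path F x (rcons p y).
Proof.
move=> [pp pm _ pnew].
have yF c : c \in val (val y) -> c \notin F ++ path_coords (x :: p).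
  by move=> /tnthP[j ->]; apply: pnew.
apply: avoiding_path_rcons => //; apply/andP; split.
  apply/coord_disjointP => c cl; apply/negP => /yF; apply/negP; rewrite negbK.
  rewrite mem_cat; apply/orP; right; apply/path_coordsP.
  by exists (last x p) => //; apply: mem_last.
by apply/forallP => i; apply: pm; rewrite -ltnS.
Qed.

Definition reach F x t : {set vertices G} :=
  [set y | `[< exists p, [/\ avoiding_path F x p, size p = t & last x p = y] >]].

Definition partial_reach F x t k : {set vertices G} :=
  [set y | `[< exists2 p, size p = t & partial_step F x p k y >]].

Lemma reachP F x t y :
  reflect (exists p, [/\ avoiding_path F x p, size p = t & last x p = y])
          (y \in reach F x t).
Proof. by rewrite inE; apply: asboolP. Qed.

Lemma partial_reachP F x t k y :
  reflect (exists2 p, size p = t & partial_step F x p k y)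
          (y \in partial_reach F x t k).
Proof. by rewrite inE; apply: asboolP. Qed.

(** A vertex of a line of direction [s k] is determined by its coordinate at [s k]. For a missed
    vertex this coordinate is forbidden or already used; [t.+1] counts the [t] steps and the start
    [x]. *)
Lemma card_line_partial_reach F x t (k : 'I_r) y :
  y \in partial_reach F x t k ->
  (#|line (s k) y :\: partial_reach F x t k.+1| <= size F + t.+1 * r)%N.
Proof.
move=> /partial_reachP[p pt py].
have <- : size (F ++ path_coords (x :: p)) = (size F + t.+1 * r)%N.
  by rewrite size_cat size_path_coords /= pt.
set A := _ :\: _; rewrite cardE -(size_map (fun z => tnth (val z) (s k))).
apply: uniq_leq_size => [|c /mapP[z]]; last first.
  rewrite mem_enum => /setDP[zy zN] ->.
  apply: contraR zN => zF; apply/partial_reachP; exists p => //.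
  exact: partial_stepS py zy zF.
rewrite map_inj_in_uniq ?enum_uniq // => z z'; rewrite !mem_enum.
move=> /setDP[/lineP zy _] /setDP[/lineP zy' _] zz'.
apply/val_inj/eq_from_tnth => j; have [->//|js] := eqVneq j (s k).
by rewrite -zy // -zy'.
Qed.

Variables (R : realType) (lam : R) (d : nat).
Hypotheses (r0 : (0 < r)%N) (lam01 : 0 < lam < 1).
Hypothesis exp : expander (@line_adj r G) lam.
Hypothesis degG : forall x i, (d <= dir_degree i x)%N.

Lemma reach_growth F x t :
  320 * r%:R * (size F + t.+1 * r)%:R <= lam * d%:R :> R ->
  4 * #|{: vertices G}|%:R <= 5 * #|reach F x t.+1|%:R :> R \/
  (1 + lam / 12) * #|reach F x t|%:R <= #|reach F x t.+1|%:R :> R.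
Proof.
move=> dF; have /andP[lam0 lam1] := lam01.
have r1R : 1 <= r%:R :> R by rewrite ler1n.
have last_step : (#|partial_reach F x t r| <= #|reach F x t.+1|)%N.
  apply/subset_leq_card/fintype.subsetP => y /partial_reachP[p pt py].
  apply/reachP; exists (rcons p y); rewrite size_rcons pt last_rcons.
  by split=> //; apply: partial_step_full.
have first_step : (#|reach F x t| <= #|partial_reach F x t 0|)%N.
  apply/subset_leq_card/fintype.subsetP => y /reachP[p [pp pt <-]].
  by apply/partial_reachP; exists p => //; apply: partial_step0.
have := @round_growth R r G s lam (partial_reach F x t) r0 lam01 exp.
move: last_step first_step; rewrite -!(ler_nat R) => last_step first_step.
case=> [k y ykt|h|h].
- have := card_line_partial_reach ykt; have := degG y (s k).
  rewrite -card_line -(finset.cardsID (partial_reach F x t k.+1) (line (s k) y)).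
  rewrite -!(ler_nat R) natrD; set del := lam / _.
  have del0 : 0 < del by rewrite divr_gt0 ?mulr_gt0 //; lra.
  have del1 : del <= 1.
    by rewrite ler_pdivrMr; nra.
  have lamE : lam = 160 * r%:R * del.
    by rewrite /del; field; rewrite gt_eqF //; lra.
  (* If a line has [m] missed and [h] reached vertices, then [2 * m <= del * d], [d <= h + m] and
     [del <= 1] give [m <= del * h]. *)
  have {}dF : 2 * (size F + t.+1 * r)%:R <= del * d%:R.
    rewrite -(@ler_pM2l _ (160 * r%:R)); first by rewrite lamE in dF; lra.
    by rewrite mulr_gt0 //; lra.
  move: dF (ler0n R #|line (s k) y :\: partial_reach F x t k.+1|) => bd a0 da ab.
  have := ler_wpM2l (ltW del0) da; nra.
- by left; lra.
- right; apply: le_trans last_step; apply: le_trans h.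
  by rewrite ler_wpM2l //; lra.
Qed.

(** Otherwise every round multiplies the reached set by [1 + lam / 12], and after [l] rounds it
    would exceed the whole vertex set. The bound [0 < t] keeps the paths, hence the final cycle,
    nonempty. *)
Lemma reach_most F x l :
  320 * r%:R * (size F + l * r)%:R <= lam * d%:R :> R ->
  #|{: vertices G}|%:R < (1 + lam / 12) ^+ l ->
  exists2 t, (0 < t <= l)%N & (4 * #|{: vertices G}| <= 5 * #|reach F x t|)%N.
Proof.
move=> dF nl; have /andP[lam0 _] := lam01.
apply: contrapT => /forall2NP nreach.
suff growth t : (t <= l)%N -> (1 + lam / 12) ^+ t <= #|reach F x t|%:R.
  have := growth l (leqnn l); apply/negP; rewrite -ltNge.
  by rewrite (le_lt_trans _ nl) // ler_nat max_card.
elim: t => [|t IH] tl.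
  rewrite expr0 ler1n; apply/card_gt0P; exists x.
  by apply/reachP; exists [::]; split.
case: (@reach_growth F x t) => [|h|h].
- apply: le_trans dF; apply: ler_wpM2l; first by rewrite mulr_ge0.
  by rewrite ler_nat leq_add2l leq_mul2r tl orbT.
- case: (nreach t.+1) => -[]; first by rewrite tl.
  by rewrite -(ler_nat R) !natrM.
- rewrite exprS; apply: le_trans h; apply: ler_wpM2l; first by lra.
  exact: IH (ltnW tl).
Qed.

End AvoidingPaths.

(** * Spreading the choices evenly, and an averaging argument over triples *)

Lemma sum_count_mem_le (T : finType) (C : eqType) (A : {set T})
    (S : T -> seq C) (F : seq C) (m : nat) :
  uniq F -> (forall y, y \in A -> (size (S y) <= m)%N) ->
  (\sum_(c <- F) #|[set y in A | c \in S y]| <= #|A| * m)%N.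
Proof.
move=> uF Sm.
rewrite (eq_bigr (fun c => \sum_(y in A) (c \in S y : nat))%N); last first.
  move=> c _; rewrite -sum1_card big_mkcond [RHS]big_mkcond /=.
  by apply: eq_bigr => y _; rewrite inE; case: (y \in A); case: (c \in S y).
(* Double counting: as [F] has no repetition, each [y] contributes at most [size (S y)]. *)
rewrite exchange_big -sum_nat_const; apply: leq_sum => y yA.
rewrite -(leq_pmul2r (ltn0Sn 0)) !muln1; apply: leq_trans (Sm y yA).
rewrite -big_mkcond sum1_count -size_filter.
apply: uniq_leq_size; first exact: filter_uniq.
by move=> c; rewrite mem_filter => /andP[].
Qed.

(* Choose the q's one by one; the forbidden list F consists of the saturated
   elements, those c with #|T| <= K * (multiplicity of c so far). *)
Lemma spread_choice (T : finType) (C : eqType) (P : Type) (q0 : P)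
    (good : T -> P -> Prop) (supp : P -> seq C) (K m : nat) :
  (0 < K <= #|T|)%N ->
  (forall y q, good y q -> (size (supp q) <= m)%N) ->
  (forall F, (size F <= K * m)%N ->
     exists2 S : {set T}, (4 * #|T| <= 5 * #|S|)%N &
       forall y, y \in S -> exists2 q, good y q & forall c, c \in supp q -> c \notin F) ->
  exists (A : {set T}) (p : T -> P),
    [/\ (4 * #|T| <= 5 * #|A|)%N, forall y, y \in A -> good y (p y)
      & forall c, (K * #|[set y in A | c \in supp (p y)]| < 2 * #|T|)%N].
Proof.
move=> /andP[K0 KT] gm rob; have T0 := leq_trans K0 KT.
(* One index is added per step until [A] has 4/5 of [T]; at [k = #|T|] both alternatives give
   this. *)
suff /(_ #|T|)[A [p [Abig gA cA]]] : forall k, exists (A : {set T}) (p : T -> P),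
    [/\ (k <= #|A|)%N || (4 * #|T| <= 5 * #|A|)%N,
        forall y, y \in A -> good y (p y)
      & forall c, (K * #|[set y in A | c \in supp (p y)]| < 2 * #|T|)%N].
  by exists A, p; split=> //; move: Abig (max_card A); lia.
elim=> [|k [A [p [Abig gA cA]]]].
  exists finset.set0, (fun=> q0); split=> // [y|c]; first by rewrite inE.
  rewrite (_ : [set y in _ | _] = finset.set0) ?cards0 ?muln0 ?muln_gt0 //.
  by apply/setP => y; rewrite !inE.
have [A4|A4] := leqP (4 * #|T|) (5 * #|A|).
  by exists A, p; rewrite A4 orbT.
have {Abig} kA : (k <= #|A|)%N by case/orP: Abig => //; rewrite leqNgt A4.
pose mult c := #|[set y in A | c \in supp (p y)]|.
pose F := [seq c <- undup (flatten [seq supp (p y) | y <- enum A]) | (#|T| <= K * mult c)%N].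
have unsat c : c \notin F -> (K * mult c < #|T|)%N.
  rewrite mem_filter mem_undup negb_and -ltnNge => /orP[//|cU].
  rewrite /mult (_ : [set y in A | _] = finset.set0) ?cards0 ?muln0 //.
  apply/setP => y; rewrite !inE; apply/negP => /andP[yA cy].
  case/flattenP: cU; exists (supp (p y)) => //.
  by apply/mapP; exists y => //; rewrite mem_enum.
(* The multiplicities add up to at most [#|T| * m], and each saturated element takes at least
   [#|T| / K] of this total. *)
have Fsize : (size F <= K * m)%N.
  rewrite -(leq_pmul2r T0) -mulnA.
  apply: (@leq_trans (\sum_(c <- F) K * mult c)).
    rewrite -sum1_size big_distrl /= big_seq [X in (_ <= X)%N]big_seq.
    by apply: leq_sum => c; rewrite mem_filter mul1n => /andP[].
  rewrite -big_distrr leq_pmul2l // [(m * _)%N]mulnC.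
  apply: leq_trans (sum_count_mem_le _ _) _.
  - by rewrite filter_uniq // undup_uniq.
  - by move=> y /gA; apply: gm.
  - by rewrite leq_mul2r max_card orbT.
have [S S4 Sgood] := rob F Fsize.
have /subsetPn[y0 y0S y0A] : ~~ (S \subset A).
  by apply/negP => /subset_leq_card; lia.
have [q qg qF] := Sgood y0 y0S.
exists (y0 |: A), (fun y => if y == y0 then q else p y).
split=> [|y|c].
- by rewrite cardsU1 y0A add1n ltnS kA.
- by rewrite !inE; case: eqP => [-> //|_] /= /gA.
(* An element of [supp q] is unsaturated and gains at most one occurrence:
   [K + K * mult c < 2 * #|T|], since [K <= #|T|]. *)
- have [cq|cq] := boolP (c \in supp q).
    have sub : [set y in y0 |: A | c \in supp (if y == y0 then q else p y)]
        \subset y0 |: [set y in A | c \in supp (p y)].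
      by apply/fintype.subsetP => y; rewrite !inE; case: eqP.
    have le1 := leq_trans (subset_leq_card sub) (leq_card_setU _ _).
    rewrite cards1 in le1; apply: (@leq_ltn_trans (K * (1 + mult c))).
      by rewrite leq_pmul2l.
    by rewrite mulnDr muln1 mul2n -addnn -addnS leq_add // unsat // qF.
  apply: leq_ltn_trans (cA c); rewrite leq_mul2l; apply/orP; right.
  apply/subset_leq_card/fintype.subsetP => y; rewrite !inE.
  by case: eqP => //= _; rewrite (negbTE cq).
Qed.

Lemma card_has_le (T : finType) (C : eqType) (A : {set T}) (S : T -> seq C)
    (F : seq C) :
  (#|[set z in A | has (mem (S z)) F]| <= \sum_(c <- F) #|[set z in A | c \in S z]|)%N.
Proof.
elim: F => [|c F IH].
  by rewrite big_nil leqn0 cards_eq0; apply/eqP/setP => z; rewrite !inE andbF.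
rewrite big_cons; apply: (leq_trans _ (leq_add (leqnn _) IH)).
apply: leq_trans (leq_card_setU _ _).
by apply/subset_leq_card/fintype.subsetP => z; rewrite !inE /= andb_orr.
Qed.

(* First moment: the three cyclic rotations of bad have the same average. *)
Lemma good_triple (T : finType) (bad : T -> T -> T -> bool) :
  (0 < #|T|)%N ->
  (forall x, 40 * \sum_y \sum_z bad x y z <= 13 * #|T| ^ 2)%N ->
  exists x y z, [/\ ~~ bad x y z, ~~ bad y z x & ~~ bad z x y].
Proof.
move=> T0 few; apply: contrapT => none.
have all_bad x y z : (1 <= bad x y z + bad y z x + bad z x y)%N.
  have [b1|b1] := boolP (bad x y z) => //.
  have [b2|b2] := boolP (bad y z x) => //.
  have [b3|b3] := boolP (bad z x y) => //.
  by case: none; exists x, y, z.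
have few3 : (40 * \sum_x \sum_y \sum_z bad x y z <= #|T| * (13 * #|T| ^ 2))%N.
  by rewrite big_distrr /= -sum_nat_const; apply: leq_sum.
have : (#|T| * (#|T| * #|T|) <= \sum_x \sum_y \sum_z
    (bad x y z + bad y z x + bad z x y))%N.
  rewrite -sum_nat_const; apply: leq_sum => x _.
  rewrite -sum_nat_const; apply: leq_sum => y _.
  by rewrite -sum1_card; apply: leq_sum.
have -> : (\sum_x \sum_y \sum_z (bad x y z + bad y z x + bad z x y) =
    \sum_x \sum_y \sum_z bad x y z + \sum_x \sum_y \sum_z bad y z x
    + \sum_x \sum_y \sum_z bad z x y)%N.
  rewrite -!big_split; apply: eq_bigr => x _; rewrite -!big_split.
  by apply: eq_bigr => y _; rewrite -!big_split.
have -> : (\sum_x \sum_y \sum_z bad y z x = \sum_x \sum_y \sum_z bad x y z)%N.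
  by rewrite exchange_big; apply: eq_bigr => y _; rewrite exchange_big.
have -> : (\sum_x \sum_y \sum_z bad z x y = \sum_x \sum_y \sum_z bad x y z)%N.
  under eq_bigr do rewrite exchange_big.
  by rewrite exchange_big.
(* The three equal sums, each at most 13/40 of [#|T| ^ 3], cannot add up to [#|T| ^ 3]. *)
move: few3; rewrite mulnCA expnS expn1; have : (0 < #|T| * (#|T| * #|T|))%N.
  by rewrite !muln_gt0 T0.
by move: (#|T| * _)%N => N; lia.
Qed.

(** * Closing three paths into a short cycle *)

Section ShortCycle.
Variables (R : realType) (r : nat) (G : line_graph r) (s : 'S_r) (lam : R).
Variables (d l : nat).
Hypotheses (r0 : (0 < r)%N) (lam01 : 0 < lam < 1).
Hypothesis exp : expander (@line_adj r G) lam.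
Hypothesis degG : forall (x : vertices G) i, (d <= dir_degree i x)%N.
Hypothesis l_le : (0 < 16 * (l * r) <= #|{: vertices G}|)%N.
Hypothesis dl :
  320 * r%:R * (16 * (l * r) * (l * r) + l * r)%:R <= lam * d%:R :> R.
Hypothesis nl : #|{: vertices G}|%:R < (1 + lam / 12) ^+ l.

Definition good_path (x y : vertices G) (q : seq (vertices G)) : Prop :=
  [/\ avoiding_path s [::] x q, last x q = y & (0 < size q <= l)%N].

(** [spread_choice] is applied with [K = 16 * (l * r)] and [m = l * r]. The forbidden lists then
    have at most [16 * (l * r) * (l * r)] entries, which [dl] leaves room for. *)
Lemma spread_paths x :
  exists (A : {set vertices G}) (p : vertices G -> seq (vertices G)),
    [/\ (4 * #|{: vertices G}| <= 5 * #|A|)%N,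
        forall y, y \in A -> good_path x y (p y)
      & forall c, (8 * (l * r) * #|[set y in A | c \in path_coords (p y)]|
                   < #|{: vertices G}|)%N].
Proof.
have [y q [_ _ /andP[_ ql]]|F Fl|A [p [A4 gA cA]]] :=
  @spread_choice _ _ _ [::] (good_path x) (@path_coords r G) _ (l * r) l_le.
- by rewrite size_path_coords leq_mul2r ql orbT.
- have [|t tl t4] := reach_most s r0 lam01 exp degG (F := F) x _ nl.
    apply: le_trans dl; apply: ler_wpM2l; first by rewrite mulr_ge0.
    by rewrite ler_nat leq_add2r.
  exists (reach s F x t) => // y /reachP[q [/and3P[qp qd qF] qt qy]].
  exists q; last by move=> c cq; apply: (allP qF).
  by split; rewrite ?qt //; apply/and3P; split=> //; apply/allP.
- by exists A, p; split=> // c; move: (cA c); rewrite -[16%N]/(2 * 8)%N -!mulnA ltn_pmul2l.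
Qed.

Lemma short_sigma_cycle :
  exists c : seq (vertices G), sigma_cycle s c /\ (size c <= 3 * l)%N.
Proof.
have [A /choice[p Ap]] := choice spread_paths.
pose meets (q q' : seq (vertices G)) := has (mem (path_coords q')) (path_coords q).
(* A missing path from [y] to [z] is not counted here but in the rotation [bad y z x]. *)
pose bad x y z := (y \notin A x) || (z \in A y) && meets (p x y) (p y z).
have n0 : (0 < #|{: vertices G}|)%N by case/andP: l_le => l0; apply: leq_trans.
have [|x [y [z []]]] := @good_triple _ bad n0.
  move=> x; have [A4 gA _] := Ap x.
  (* If [y \in A x], the at most [l * r] coordinates of [p x y] each lie on fewer than
     [n / (8 * l * r)] paths from [y], so at most [n / 8] vertices [z] are bad. Otherwise all [n]
     are. *)
  have few_z y : (8 * \sum_z bad x y z <=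
      #|{: vertices G}| + 7 * #|{: vertices G}| * (y \notin A x))%N.
    rewrite /bad; have [yA|yA] /= := boolP (y \in A x); last first.
      by rewrite sum1_card muln1 -mulSn.
    rewrite muln0 addn0.
    have -> : (\sum_z ((z \in A y) && meets (p x y) (p y z)) =
        #|[set z in A y | meets (p x y) (p y z)]|)%N.
      rewrite -sum1_card [RHS]big_mkcond; apply: eq_bigr => z _.
      by rewrite inE; case: (_ && _).
    have [_ _ cA] := Ap y; have [_ _ /andP[_ pl]] := gA y yA.
    have lr0 : (0 < l * r)%N by case/andP: l_le; rewrite muln_gt0.
    rewrite -(leq_pmul2l lr0) mulnA [(l * r * 8)%N]mulnC.
    apply: (@leq_trans (size (p x y) * r * #|{: vertices G}|)); last first.
      by rewrite leq_mul2r leq_mul2r pl !orbT.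
    rewrite -size_path_coords -sum1_size big_distrl /=.
    apply: leq_trans (_ : 8 * (l * r) * \sum_(c <- path_coords (p x y))
      #|[set z in A y | c \in path_coords (p y z)]| <= _)%N.
      by rewrite leq_mul2l card_has_le orbT.
    by rewrite big_distrr /=; apply: leq_sum => c _; rewrite mul1n ltnW.
  have : (8 * \sum_y \sum_z bad x y z <= #|{: vertices G}| * #|{: vertices G}|
      + 7 * #|{: vertices G}| * #|~: A x|)%N.
    rewrite big_distrr /=; apply: leq_trans (leq_sum _ (fun y _ => few_z y)) _.
    rewrite big_split /= sum_nat_const leq_add2l -big_distrr leq_mul2l.
    suff -> : (\sum_y (y \notin A x) = #|~: A x|)%N by rewrite leqnn orbT.
    rewrite -sum1_card [RHS]big_mkcond; apply: eq_bigr => y _.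
    by rewrite inE; case: (y \in A x).
  have := cardsC (A x); move: A4.
  move: #|A x| #|~: A x| #|{: vertices G}| => a b n; rewrite expnS expn1.
  (* Then [8 * S <= n ^ 2 + 7 * n * b] gives at most 12/40 of [n ^ 2]. *)
  move=> ? ?; have : (5 * b <= n)%N by lia.
  move: (\sum_y _)%N => S; nia.
rewrite /bad !negb_or !negbK !negb_and => /andP[yA zxy] /andP[zA xyz] /andP[xA yzx].
rewrite zA /= in zxy; rewrite xA /= in xyz; rewrite yA /= in yzx.
have [_ /(_ y yA)[/and3P[pxy dxy _] lxy /andP[sxy lexy]] _] := Ap x.
have [_ /(_ z zA)[/and3P[pyz dyz _] lyz /andP[_ leyz]] _] := Ap y.
have [_ /(_ x xA)[/and3P[pzx dzx _] lzx /andP[_ lezx]] _] := Ap z.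
have apart q q' : ~~ meets q q' ->
    allrel (@coord_disjoint r G) q q' && allrel (@coord_disjoint r G) q' q.
  move=> /hasPn qq'.
  have disj a b c : a \in q -> b \in q' -> c \in val (val a) -> c \notin val (val b).
    move=> aq bq' ca; have /qq' : c \in path_coords q by apply/path_coordsP; exists a.
    by apply: contra => cb; apply/path_coordsP; exists b.
  apply/andP; split; apply/allrelP => a b aq bq; apply/coord_disjointP => c ca.
    exact: disj aq bq ca.
  by apply/negP => cb; have := disj b a c bq aq cb; rewrite ca.
have /andP[xy_yz _] := apart _ _ zxy.
have /andP[yz_zx _] := apart _ _ xyz.
have /andP[_ xy_zx] := apart _ _ yzx.
(* Each path omits its start and contains its end, so [x], [y] and [z] are listed once each. *)
exists (p x y ++ p y z ++ p z x); split; last by rewrite !size_cat !mulSn addn0 !leq_add.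
split.
- by rewrite size_cat addn_gt0 sxy.
- rewrite !pairwise_cat allrel_catr xy_yz yz_zx xy_zx /=.
  by move: dxy dyz dzx => /= /andP[_ ->] /andP[_ ->] /andP[_ ->].
- by rewrite (cycle_path x) !last_cat lxy lyz lzx !cat_path lxy lyz pxy pyz.
Qed.

End ShortCycle.

(** * Numerical estimates and the choice of parameters *)

Lemma lt_expr_log2 (R : realType) (lam : R) (n l : nat) :
  (1 < n)%N -> 0 < lam < 1 -> 13 * log2 n%:R < lam * l%:R :> R ->
  n%:R < (1 + lam / 12) ^+ l.
Proof.
move=> n1 /andP[lam0 lam1] Ll.
have ln2_gt0 : 0 < ln 2 :> R by apply: ln_gt0; lra.
have ln2_le1 : ln 2 <= 1 :> R by have := @le_ln1Dx R 1; rewrite -[1 + 1]/2; apply; lra.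
have n0 : 0 < n%:R :> R by rewrite ltr0n (ltn_trans _ n1).
have lnE : log2 n%:R * ln 2 = ln n%:R :> R by rewrite /log2 mulfVK ?gt_eqF.
have lnn0 : 0 < log2 n%:R :> R by rewrite divr_gt0 // ln_gt0 // ltr1n.
(* The chain is [(1 + y) ^+ l >= expR (t * l) >= expR (lam * l / 13) > expR (log2 n) >= n]; the last
   inequality holds because [ln 2 <= 1]. *)
set y := lam / 12; have y0 : 0 < y by rewrite divr_gt0.
set t := y / (1 + y).
have tlam : lam <= 13 * t.
  by rewrite /t mulrA ler_pdivlMr /y; nra.
(* (1 + y)^-1 = 1 - t <= exp (- t) *)
have expt : expR t <= 1 + y.
  have := expR_ge1Dx (- t); rewrite expRN.
  have -> : 1 - t = (1 + y)^-1 by rewrite /t; field; rewrite gt_eqF //; lra.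
  by rewrite lef_pV2 // posrE ?expR_gt0 //; lra.
apply: (@lt_le_trans _ _ (expR t ^+ l)); last first.
  by apply: lerXn2r => //; rewrite nnegrE ?expR_ge0 //; lra.
rewrite -expRM_natl -[ltLHS](@lnK R) ?posrE // ltr_expR -lnE.
have := ler_wpM2l (ler0n R l) tlam; nra.
Qed.

Lemma nat_between_19_20 (R : realType) (a : R) :
  1 < a -> exists l : nat, 19 * a < l%:R <= 20 * a.
Proof.
move=> a1; exists (Num.truncn (20 * a)).
have /truncn_itv /andP[le1 gt1] : 0 <= 20 * a by lra.
by apply/andP; split=> //; move: gt1; rewrite -natr1; lra.
Qed.

Theorem theorem4p2 (R : realType) (r : nat) (hr : (0 < r)%N) :
  exists n0 : nat,
  forall (s : 'S_r) (eps lam : R) (n d : nat),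
    0 < eps < 1 -> 0 < lam < 1 -> (0 < n)%N -> (0 < d)%N ->
    d%:R >= 4000 * r%:R ^+ 5 * log2 n%:R ^+ 2 / (eps ^+ 3 * lam ^+ 3) :> R ->
    lam / (4 * r%:R) <= eps -> eps < 1 / 12 ->
    (n0 <= n)%N ->
  forall G : line_graph r,
    #|{: vertices G}| = n -> line_expander G lam d ->
    exists c : seq (vertices G),
      sigma_cycle s c /\
      (size c)%:R <= 30 * r%:R * log2 n%:R / (eps * lam) :> R.
Proof.
(* [2 <= n] gives [1 <= log2 n], hence [1 < a] below; that [n] is large compared with [l * r] will
   follow from [d <= n]. *)
exists 2%N => s eps lam n d /andP[eps0 _] lam01 n0 d0 dbig _ eps12 n2 G Gn [exp].
have /andP[lam0 lam1] := lam01.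
rewrite leq_min_degree // ?Gn // => degG.
have dn : (d <= n)%N.
  have /card_gt0P[x _] : (0 < #|{: vertices G}|)%N by rewrite Gn.
  by rewrite -Gn (leq_trans (degG x (Ordinal hr))) // dir_degree_le.
have r1 : 1 <= r%:R :> R by rewrite ler1n.
have L1 : 1 <= log2 n%:R :> R.
  have ln2_gt0 : 0 < ln 2 :> R by apply: ln_gt0; lra.
  by rewrite /log2 ler_pdivlMr // mul1r ler_ln ?posrE ?ltr0n // ler_nat.
set a := log2 n%:R / lam.
have aE : log2 n%:R = a * lam by rewrite /a mulfVK ?gt_eqF.
have a1 : 1 < a by rewrite /a ltr_pdivlMr // mul1r; lra.
have [l /andP[l19 l20]] := nat_between_19_20 a1.
have l0 : (0 < l)%N by rewrite -(ltr0n R); lra.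
(* The constant comes from [16 * (l * r) ^ 2 + l * r <= 17 * (l * r) ^ 2] and [l <= 20 * a]. It is
   below [4000 * 12 ^ 3], which the bound on [d] provides as [eps < 1 / 12]. *)
have lamd : 320 * 17 * 20 ^+ 2 * (r%:R ^+ 5 * a ^+ 2) <= lam * d%:R.
  have : lam * (4000 * r%:R ^+ 5 * log2 n%:R ^+ 2 / (eps ^+ 3 * lam ^+ 3)) <= lam * d%:R.
    by rewrite ler_pM2l.
  apply: le_trans; clear dbig.
  have -> : lam * (4000 * r%:R ^+ 5 * log2 n%:R ^+ 2 / (eps ^+ 3 * lam ^+ 3))
      = eps^-1 ^+ 3 * 4000 * (r%:R ^+ 5 * a ^+ 2).
    by rewrite aE; field; rewrite !gt_eqF.
  have e12 : 12 <= eps^-1 by rewrite -[12]invrK lef_pV2 ?posrE //; lra.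
  have e1728 : 12 ^+ 3 <= eps^-1 ^+ 3.
    by apply: lerXn2r => //; rewrite nnegrE //; lra.
  apply: ler_wpM2r; first by apply: mulr_ge0; apply: exprn_ge0; lra.
  by lra.
clear dbig.
have ra : l%:R * r%:R <= 20 * (r%:R * a) by nra.
have lr1 : 1 <= l%:R * r%:R :> R by rewrite -natrM ler1n muln_gt0 l0.
have r35 : r%:R ^+ 3 * a ^+ 2 <= r%:R ^+ 5 * a ^+ 2.
  by rewrite ler_wpM2r ?exprn_ge0 ?ler_weXn2l //; lra.
have r13 : r%:R * a <= r%:R ^+ 3 * a ^+ 2.
  have -> : r%:R ^+ 3 * a ^+ 2 = r%:R * a * (r%:R ^+ 2 * a) by ring.
  rewrite ler_peMr //; first by nra.
  by rewrite expr2; nra.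
have [|||c [cc cl]] := @short_sigma_cycle R r G s lam d l hr lam01 exp degG.
- rewrite !muln_gt0 l0 hr Gn /= (leq_trans _ dn) // -(ler_nat R) !natrM.
  apply: (@le_trans _ _ (lam * d%:R)); first by lra.
  by rewrite ler_piMl // ltW.
- apply: le_trans lamd; rewrite natrD !natrM.
  have : (l%:R * r%:R) ^+ 2 <= (20 * (r%:R * a)) ^+ 2.
    by rewrite lerXn2r ?nnegrE //; lra.
  move=> /(ler_wpM2l (ler0n R r)).
  have -> : r%:R * (20 * (r%:R * a)) ^+ 2 = 400 * (r%:R ^+ 3 * a ^+ 2) by ring.
  have : l%:R * r%:R <= (l%:R * r%:R) ^+ 2 :> R by rewrite expr2 ler_peMr //; lra.
  move=> /(ler_wpM2l (ler0n R r)).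
  by lra.
- by rewrite Gn; apply: lt_expr_log2 => //; rewrite aE; nra.
exists c; split=> //; apply: (@le_trans _ _ (3 * l%:R)).
  by rewrite -natrM ler_nat.
have -> : 30 * r%:R * log2 n%:R / (eps * lam) = 30 * (r%:R * a) / eps.
  by rewrite aE; field; rewrite !gt_eqF.
(* [3 * l * eps <= 60 * a / 12 = 5 * a], well below [30 * (r * a)]. *)
rewrite ler_pdivlMr //.
have : a <= r%:R * a by rewrite ler_peMl //; lra.
nra.
Qed.
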